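(* Let $\mathbf L=\langle L,\land,\lor,',0,1\rangle$ be an involutive bisemilattice. For $x\in L$ put $\uparrow x=\{F\in\mathcal F(L):x\in F\}$ and $\downarrow x=\{I\in\mathcal I(L):x\notin I\}$. Let $X=\{\uparrow x:x\in L\}$ and $Y=\{\downarrow x:x\in L\}$, and define $\theta(\uparrow x)=\downarrow x$ and $(\downarrow x)^\star=\uparrow(x')$. Then these data form an IDBS of sets $\langle X,\cdot,+,{}^\dagger,\bot,\top\rangle$, and this structure is isomorphic to $\mathbf L$.
   Context: **Involutive bisemilattices.** An involutive bisemilattice is an algebra $\langle A,\land,\lor,',0,1\rangle$ satisfying: (I1) $x\lor x=x$; (I2) $x\lor y=y\lor x$; (I3) $x\lor(y\lor z)=(x\lor y)\lor z$; (I4) $x''=x$; (I5) $x\land y=(x'\lor y')'$; (I6) $x\land(x'\lor y)=x\land y$; (I7) $0\lor x=x$; (I8) $0=1'$. Write $a\le_\land b$ iff $a\land b=a$, and $a\le_\lor b$ iff $a\lor b=b$. A filter is a nonempty subset that is upward closed for $\le_\land$ and closed under $\land$. An ideal is a nonempty subset that is downward closed for $\le_\lor$ and closed under $\lor$. $\mathcal F(L)$ and $\mathcal I(L)$ denote the sets of filters and ideals. **IDBS of sets.** Let $X$ be a family of sets closed under finite intersections and $Y$ a family of sets closed under finite unions with a least element $\overline 0$. Let $\theta:X\to Y$ be a bijection such that: - for all $A,B,C\in X$: $A\cap\theta^{-1}(\theta(B)\cup\theta(C))=\theta^{-1}(\theta(A\cap B)\cup\theta(A\cap C))$; - for all $P,Q,R\in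 Y$: $P\cup\theta(\theta^{-1}(Q)\cap\theta^{-1}(R))=\theta(\theta^{-1}(P\cup Q)\cap\theta^{-1}(P\cup R))$; - for all $A,B\in X$: $\theta(A\cap(\theta(A))^\star)\subseteq\theta(A\cap B)$. Here ${}^\star:Y\to X$ is an inclusion-reversing order isomorphism with ${}^\star\circ\theta=\theta^{-1}\circ({}^\star)^{-1}$. Operations on $X$: $A+B=\theta^{-1}(\theta(A)\cup\theta(B))$, $A\cdot B=A\cap B$, $A^\dagger=(\theta(A))^\star$, $\bot=\theta^{-1}(\overline0)$, $\top=\overline0^\star$. The resulting structure is called an IDBS of sets. *)

(* Defs.v *)
From mathcomp Require Import all_boot.
From mathcomp Require Import boolp classical_sets.

Set Implicit Arguments.
Unset Strict Implicit.
Unset Printing Implicit Defensive.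

Local Open Scope classical_set_scope.

(* Algebras of type (2, 2, 1, 0, 0), without axioms. *)
Record balgebra := BAlgebra {
  carrier :> Type;
  bmeet : carrier -> carrier -> carrier;
  bjoin : carrier -> carrier -> carrier;
  bneg : carrier -> carrier;
  bzero : carrier;
  bone : carrier }.

Arguments bzero {b}.
Arguments bone {b}.

Declare Scope balgebra_scope.
Delimit Scope balgebra_scope with B.
Notation "x '⊓' y" := (bmeet x y)
  (at level 40, left associativity) : balgebra_scope.
Notation "x '⊔' y" := (bjoin x y)
  (at level 50, left associativity) : balgebra_scope.
Notation "'¬' x" := (bneg x) (at level 35, right associativity) :
  balgebra_scope.
Local Open Scope balgebra_scope.

Record involutive_bisemilattice (L : balgebra) : Prop := {
  ibs_joinxx : forall x : L, x ⊔ x = x;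
  ibs_joinC : forall x y : L, x ⊔ y = y ⊔ x;
  ibs_joinA : forall x y z : L, x ⊔ (y ⊔ z) = (x ⊔ y) ⊔ z;
  ibs_negK : forall x : L, ¬ ¬ x = x;
  ibs_meetE : forall x y : L, x ⊓ y = ¬ (¬ x ⊔ ¬ y);
  ibs_meet_neg_join : forall x y : L, x ⊓ (¬ x ⊔ y) = x ⊓ y;
  ibs_join0x : forall x : L, bzero ⊔ x = x;
  ibs_zeroE : bzero = ¬ bone :> L }.

Definition le_meet (L : balgebra) (a b : L) : Prop := a ⊓ b = a.
Definition le_join (L : balgebra) (a b : L) : Prop := a ⊔ b = b.

Record is_filter (L : balgebra) (F : set L) : Prop := {
  filter_nonempty : F !=set0;
  filter_upward : forall a b : L, F a -> le_meet a b -> F b;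
  filter_meet : forall a b : L, F a -> F b -> F (a ⊓ b) }.

Record is_ideal (L : balgebra) (I : set L) : Prop := {
  ideal_nonempty : I !=set0;
  ideal_downward : forall a b : L, I b -> le_join a b -> I a;
  ideal_join : forall a b : L, I a -> I b -> I (a ⊔ b) }.

Definition filters (L : balgebra) : set (set L) := [set F | is_filter F].
Definition ideals (L : balgebra) : set (set L) := [set I | is_ideal I].

Arguments filters L : clear implicits.
Arguments ideals L : clear implicits.

Definition balgebra_morphism (K L : balgebra) (h : K -> L) : Prop :=
  [/\ forall x y, h (x ⊓ y) = h x ⊓ h y,
      forall x y, h (x ⊔ y) = h x ⊔ h y,
      forall x, h (¬ x) = ¬ h x,
      h bzero = bzero
    & h bone = bone].

Definition isomorphic (K L : balgebra) : Prop :=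
  exists2 h : K -> L, bijective h & balgebra_morphism h.

(* A family of sets X is used as a type through the coercion set_type: an
   element A : X is a set val A together with a proof that it is in X. *)
Definition family_cap (U : Type) (X : set (set U)) (clX : setI_closed X)
    (A B : X) : X :=
  SigSub (mem_set (clX _ _ (set_mem (valP A)) (set_mem (valP B)))).

Definition family_cup (V : Type) (Y : set (set V)) (clY : setU_closed Y)
    (P Q : Y) : Y :=
  SigSub (mem_set (clY _ _ (set_mem (valP P)) (set_mem (valP Q)))).

(* The inverses of theta and star and the least element of Y are uniquely
   determined by theta, star and Y; they are fields because the operations
   on X are defined from them. *)
Record idbs_of_sets (U V : Type) (X : set (set U)) (Y : set (set V))
    (theta : X -> Y) (star : Y -> X) := IDBSOfSets {
  idbs_capX : setI_closed X;
  idbs_cupY : setU_closed Y;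
  idbs_least : Y;
  idbs_leastP : forall P : Y, val idbs_least `<=` val P;
  theta_inv : Y -> X;
  thetaK : cancel theta theta_inv;
  theta_invK : cancel theta_inv theta;
  star_inv : X -> Y;
  starK : cancel star star_inv;
  star_invK : cancel star_inv star;
  star_antimono : forall P Q : Y,
    val P `<=` val Q <-> val (star Q) `<=` val (star P);
  star_theta : star \o theta =1 theta_inv \o star_inv;
  idbs_cap_distr : forall A B C : X,
    let cap := family_cap idbs_capX in
    let cup := family_cup idbs_cupY in
    cap A (theta_inv (cup (theta B) (theta C))) =
    theta_inv (cup (theta (cap A B)) (theta (cap A C)));
  idbs_cup_distr : forall P Q R : Y,
    let cap := family_cap idbs_capX in
    let cup := family_cup idbs_cupY in
    cup P (theta (cap (theta_inv Q) (theta_inv R))) =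
    theta (cap (theta_inv (cup P Q)) (theta_inv (cup P R)));
  idbs_cap_dagger : forall A B : X,
    let cap := family_cap idbs_capX in
    val (theta (cap A (star (theta A)))) `<=` val (theta (cap A B)) }.

Definition idbs_algebra (U V : Type) (X : set (set U)) (Y : set (set V))
    (theta : X -> Y) (star : Y -> X) (S : idbs_of_sets theta star) :
    balgebra :=
  {| carrier := X;
     bmeet := family_cap (idbs_capX S);
     bjoin := fun A B =>
       theta_inv S (family_cup (idbs_cupY S) (theta A) (theta B));
     bneg := fun A => star (theta A);
     bzero := theta_inv S (idbs_least S);
     bone := star (idbs_least S) |}.

Definition up (L : balgebra) (x : L) : set (set L) :=
  [set F | filters L F /\ F x].

Definition down (L : balgebra) (x : L) : set (set L) :=
  [set I | ideals L I /\ ~ I x].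

Definition ups (L : balgebra) : set (set (set L)) := range (@up L).
Definition downs (L : balgebra) : set (set (set L)) := range (@down L).

Arguments ups L : clear implicits.
Arguments downs L : clear implicits.

Definition to_ups (L : balgebra) (x : L) : ups L :=
  SigSub (mem_set (imageT (@up L) x)).
Definition to_downs (L : balgebra) (x : L) : downs L :=
  SigSub (mem_set (imageT (@down L) x)).

(* Main.v *)
(* The laws of an involutive bisemilattice force distributivity.  Writing
   e x = x ⊓ ¬ x, one gets e (x ⊔ y) = e (x ⊓ y) = e x ⊓ y = e x ⊔ e y, and
   these "local zeros" show that ⊓ preserves being ⊔-above a given element,
   which is the one step of distributivity that (I6) does not give directly.
   A filter contains x ⊓ y iff it contains both x and y, and an ideal contains
   x ⊔ y iff it contains both, so up turns ⊓ into intersection and down turns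
   ⊔ into union; both are injective, as principal filters and ideals separate
   points.  Hence up and down transport the structure of L to the families. *)
Require Import Defs.
From mathcomp Require Import all_boot.
From mathcomp Require Import boolp classical_sets.

Set Implicit Arguments.
Unset Strict Implicit.

Local Open Scope classical_set_scope.
Local Open Scope balgebra_scope.

Section InvolutiveBisemilattice.
Variables (L : balgebra) (hL : involutive_bisemilattice L).
Implicit Types a b p q x y z : L.

Let joinxx := ibs_joinxx hL.
Let joinC := ibs_joinC hL.
Let joinA := ibs_joinA hL.
Let negK := ibs_negK hL.
Let meetE := ibs_meetE hL.
Let meet_neg_join := ibs_meet_neg_join hL.

Lemma ibs_neg_meet x y : ¬ (x ⊓ y) = ¬ x ⊔ ¬ y.
Proof. by rewrite meetE negK. Qed.

Lemma ibs_neg_join x y : ¬ (x ⊔ y) = ¬ x ⊓ ¬ y.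
Proof. by rewrite meetE !negK. Qed.

Lemma ibs_meetxx x : x ⊓ x = x.
Proof. by rewrite meetE joinxx negK. Qed.

Lemma ibs_meetC x y : x ⊓ y = y ⊓ x.
Proof. by rewrite !meetE joinC. Qed.

Lemma ibs_meetA x y z : x ⊓ (y ⊓ z) = (x ⊓ y) ⊓ z.
Proof. by rewrite !meetE !negK joinA. Qed.

Lemma ibs_meetCA x y z : x ⊓ (y ⊓ z) = y ⊓ (x ⊓ z).
Proof. by rewrite !ibs_meetA (ibs_meetC x). Qed.

(** De Morgan dual of (I6). *)
Lemma ibs_join_neg_meet x y : x ⊔ (¬ x ⊓ y) = x ⊔ y.
Proof.
rewrite -[RHS]negK ibs_neg_join -[in RHS]meet_neg_join.
by rewrite ibs_neg_meet ibs_neg_join !negK.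
Qed.

(** The bottom of the Boolean fibre of [x] when [L] is seen as a Płonka sum of Boolean algebras. *)
Definition local_zero x := x ⊓ ¬ x.
Local Notation e := local_zero.

Lemma local_zero_neg x : e (¬ x) = e x.
Proof. by rewrite /e negK ibs_meetC. Qed.

Lemma local_zero_join_neg x y : e (x ⊔ y) = ¬ x ⊓ e y.
Proof.
have := meet_neg_join (¬ x) y; rewrite negK => I6.
by rewrite /e ibs_neg_join ibs_meetCA !ibs_meetA I6.
Qed.

(** The right side is [x ⊓ e (x ⊔ y)]; since [e (x ⊔ y)] is also [¬ y ⊓ e x], it already absorbs
    [x]. *)
Lemma local_zero_join x y : e (x ⊔ y) = e x ⊓ e y.
Proof.
rewrite {2}/e -ibs_meetA -local_zero_join_neg joinC local_zero_join_neg.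
by rewrite [RHS]ibs_meetCA {2}/e (ibs_meetA x) ibs_meetxx.
Qed.

Lemma local_zero_meet x y : e (x ⊓ y) = e x ⊓ e y.
Proof.
by rewrite -local_zero_neg ibs_neg_meet local_zero_join !local_zero_neg.
Qed.

Lemma meet_local_zero x y : e x ⊓ y = e x ⊓ e y.
Proof.
rewrite ibs_meetC -{1}(negK y) -local_zero_join_neg local_zero_join.
by rewrite local_zero_neg ibs_meetC.
Qed.

Lemma local_zero_idem x : e (e x) = e x.
Proof. by rewrite {2}/e local_zero_meet local_zero_neg ibs_meetxx. Qed.

(** Under a meet with a local zero, [¬ e z] and [e z] agree ([neg_lz]). So the dual of (I6), used
    once per joinand, turns each into [e x ⊓ e y]. *)
Lemma join_local_zero x y : e x ⊔ e y = e x ⊓ e y.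
Proof.
have neg_lz z w : ¬ e z ⊓ e w = e z ⊓ e w.
  by rewrite ibs_meetC meet_local_zero local_zero_neg local_zero_idem ibs_meetC.
rewrite -ibs_join_neg_meet neg_lz -local_zero_join joinC -ibs_join_neg_meet.
rewrite neg_lz local_zero_join -ibs_meetA (ibs_meetC (e y)) ibs_meetA.
by rewrite ibs_meetxx joinxx.
Qed.

(** By (I6), [¬ x] may be joined on inside the outer meet, where it strips [x] from both inner
    meets. *)
Lemma ibs_meet_join_inner x y z : x ⊓ (y ⊔ z) = x ⊓ ((x ⊓ y) ⊔ (x ⊓ z)).
Proof.
have absorb w : ¬ x ⊔ (x ⊓ w) = ¬ x ⊔ w.
  by rewrite -{2}(negK x) ibs_join_neg_meet.
rewrite -[RHS]meet_neg_join joinA absorb -joinA (joinC y (_ ⊓ _)) joinA absorb.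
by rewrite -joinA (joinC z y) meet_neg_join.
Qed.

(** The dual of (I6) replaces [a] in the join by [a ⊓ ¬ (p ⊓ q)]. As [a ⊓ ¬ r = e r] for [r] above
    [a], this meet is [e (p ⊓ q)], which [p ⊓ q] absorbs. *)
Lemma le_join_meet a p q : le_join a p -> le_join a q -> le_join a (p ⊓ q).
Proof.
rewrite /le_join => ap aq.
have a_neg r : a ⊔ r = r -> a ⊓ ¬ r = e r.
  move=> ar; rewrite -{1}ar ibs_neg_join ibs_meetA ibs_meetC.
  by rewrite -[a ⊓ ¬ a]/(e a) -local_zero_join_neg joinC ar.
have eap : e p ⊓ a = e p by rewrite meet_local_zero -local_zero_join joinC ap.
rewrite joinC -ibs_join_neg_meet ibs_neg_meet (ibs_meetC _ a) ibs_meet_join_inner.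
rewrite !a_neg // join_local_zero ibs_meetA (ibs_meetC a) eap.
by rewrite -local_zero_meet -local_zero_neg /e negK ibs_join_neg_meet joinxx.
Qed.

(** It remains to drop the outer [x] in [ibs_meet_join_inner]: after negation, [¬ x] lies below
    [¬ (x ⊓ y)] and [¬ (x ⊓ z)], hence below their meet. *)
Lemma ibs_meet_joinr x y z : x ⊓ (y ⊔ z) = (x ⊓ y) ⊔ (x ⊓ z).
Proof.
have le_neg w : le_join (¬ x) (¬ (x ⊓ w)).
  by rewrite /le_join ibs_neg_meet joinA joinxx.
rewrite ibs_meet_join_inner -[LHS]negK ibs_neg_meet (ibs_neg_join (_ ⊓ _)).
by rewrite (le_join_meet (le_neg y) (le_neg z)) -ibs_neg_join negK.
Qed.

Lemma ibs_join_meetr x y z : x ⊔ (y ⊓ z) = (x ⊔ y) ⊓ (x ⊔ z).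
Proof.
rewrite -[LHS]negK ibs_neg_join (ibs_neg_meet y) [in LHS]ibs_meet_joinr.
by rewrite -!ibs_neg_join -ibs_neg_meet negK.
Qed.

(** Distributivity reduces this to (I6); read through [down], it is the third law of an IDBS of
    sets. *)
Lemma le_join_local_zero x y : le_join (x ⊓ ¬ x) (x ⊓ y).
Proof. by rewrite /le_join -ibs_meet_joinr meet_neg_join. Qed.

Lemma le_joinl x y : le_join x (x ⊔ y).
Proof. by rewrite /le_join joinA joinxx. Qed.

Lemma le_joinr x y : le_join y (x ⊔ y).
Proof. by rewrite joinC; apply: le_joinl. Qed.

Lemma le_meetl x y : le_meet (x ⊓ y) x.
Proof. by rewrite /le_meet ibs_meetC ibs_meetA ibs_meetxx. Qed.

Lemma le_meetr x y : le_meet (x ⊓ y) y.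
Proof. by rewrite ibs_meetC; apply: le_meetl. Qed.

Lemma le_meet_neg x y : le_meet (¬ y) (¬ x) <-> le_join x y.
Proof.
rewrite /le_meet /le_join -ibs_neg_join (joinC y).
by split=> [/(congr1 (@bneg L))|->//]; rewrite !negK.
Qed.

Lemma principal_filter x : is_filter (le_meet x).
Proof.
split; first by exists x; apply: ibs_meetxx.
- by rewrite /le_meet => a b xa ab; rewrite -xa -ibs_meetA ab.
- by rewrite /le_meet => a b xa xb; rewrite ibs_meetA xa.
Qed.

Lemma principal_ideal x : is_ideal (fun a => le_join a x).
Proof.
split; first by exists x; apply: joinxx.
- by rewrite /le_join => a b bx ab; rewrite -bx joinA ab.
- by rewrite /le_join => a b ax bx; rewrite -joinA bx.
Qed.

Lemma sub_up x y : up x `<=` up y <-> le_meet x y.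
Proof.
split=> [xy|xy F [hF Fx]]; last by split=> //; apply: (filter_upward hF) xy.
by have [] := xy _ (conj (principal_filter x) (ibs_meetxx x)).
Qed.

Lemma sub_down x y : Defs.down x `<=` Defs.down y <-> le_join x y.
Proof.
split=> [xy|xy J [hJ Jx]]; last first.
  by split=> // Jy; apply: Jx; apply: (ideal_downward hJ) xy.
(* If [x] is not below [y], the principal ideal of [y] is in [down x] but not in [down y]. *)
apply: contrapT => nxy.
by have [_] := xy _ (conj (principal_ideal y) nxy); apply; apply: joinxx.
Qed.

Lemma up_inj : injective (@up L).
Proof.
move=> x y xy; have /sub_up <- : up x `<=` up y by rewrite xy.
by rewrite ibs_meetC; apply/sub_up; rewrite xy.
Qed.

Lemma down_inj : injective (@Defs.down L).
Proof.
move=> x y xy; have /sub_down <- : Defs.down x `<=` Defs.down y by rewrite xy.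
by rewrite joinC; apply/esym/sub_down; rewrite xy.
Qed.

Lemma up_meet x y : up (x ⊓ y) = up x `&` up y.
Proof.
apply/seteqP; split=> [F [hF Fxy]|F [[hF Fx] [_ Fy]]].
  by split; split=> //; apply: (filter_upward hF) Fxy _;
    [apply: le_meetl|apply: le_meetr].
by split=> //; apply: (filter_meet hF).
Qed.

Lemma down_join x y : Defs.down (x ⊔ y) = Defs.down x `|` Defs.down y.
Proof.
apply/seteqP; split=> [J [hJ Jxy]|J [] [hJ nJ]].
- have [Jx|nJx] := pselect (J x); last by left.
  by right; split=> // Jy; apply: Jxy; apply: (ideal_join hJ).
- by split=> // Jxy; apply: nJ; apply: (ideal_downward hJ) Jxy _; apply: le_joinl.
- by split=> // Jxy; apply: nJ; apply: (ideal_downward hJ) Jxy _; apply: le_joinr.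
Qed.

Lemma ups_setI_closed : setI_closed (ups L).
Proof. by move=> _ _ [x _ <-] [y _ <-]; rewrite -up_meet; exists (x ⊓ y). Qed.

Lemma downs_setU_closed : setU_closed (downs L).
Proof. by move=> _ _ [x _ <-] [y _ <-]; rewrite -down_join; exists (x ⊔ y). Qed.

Lemma cap_to_ups (cl : setI_closed (ups L)) x y :
  family_cap cl (to_ups x) (to_ups y) = to_ups (x ⊓ y).
Proof. by apply: val_inj; rewrite /= up_meet. Qed.

Lemma cup_to_downs (cl : setU_closed (downs L)) x y :
  family_cup cl (to_downs x) (to_downs y) = to_downs (x ⊔ y).
Proof. by apply: val_inj; rewrite /= down_join. Qed.

End InvolutiveBisemilattice.

Section Representatives.
Variable L : balgebra.

(** A generator picked by choice; over an involutive bisemilattice it is unique because [up] is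
    injective. *)
Definition of_ups (A : ups L) : L := sval (cid2 (set_mem (valP A))).
Definition of_downs (P : downs L) : L := sval (cid2 (set_mem (valP P))).

Lemma of_upsK : cancel of_ups (@to_ups L).
Proof. by move=> A; apply: val_inj => /=; rewrite /of_ups; case: cid2. Qed.

Lemma of_downsK : cancel of_downs (@to_downs L).
Proof. by move=> P; apply: val_inj => /=; rewrite /of_downs; case: cid2. Qed.

Hypothesis hL : involutive_bisemilattice L.

Lemma to_upsK : cancel (@to_ups L) of_ups.
Proof. by move=> x; apply: (up_inj hL); have /(congr1 val) := of_upsK (to_ups x). Qed.

Lemma to_downsK : cancel (@to_downs L) of_downs.
Proof.
by move=> x; apply: (down_inj hL); have /(congr1 val) := of_downsK (to_downs x).
Qed.

End Representatives.

Unset Implicit Arguments.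
Set Strict Implicit.

Theorem theorem4p4 (L : balgebra) (hL : involutive_bisemilattice L) :
  exists (theta : ups L -> downs L) (star : downs L -> ups L),
    [/\ forall x : L, theta (to_ups x) = to_downs x,
        forall x : L, star (to_downs x) = to_ups (¬ x)
      & exists S : idbs_of_sets theta star, isomorphic (idbs_algebra S) L].
Proof.
pose theta (A : ups L) := to_downs (of_ups A).
pose theta' (P : downs L) := to_ups (of_downs P).
pose star (P : downs L) := to_ups (¬ of_downs P).
pose star' (A : ups L) := to_downs (¬ of_ups A).
have thE x : theta (to_ups x) = to_downs x by rewrite /theta to_upsK.
have th'E x : theta' (to_downs x) = to_ups x by rewrite /theta' to_downsK.
have stE x : star (to_downs x) = to_ups (¬ x) by rewrite /star to_downsK.
have st'E x : star' (to_ups x) = to_downs (¬ x) by rewrite /star' to_upsK.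
(* Every member of either family has a generator, so each law below becomes a statement about
   elements of [L]. *)
have upsP (A : ups L) : exists x, A = to_ups x by exists (of_ups A); rewrite of_upsK.
have downsP (P : downs L) : exists x, P = to_downs x.
  by exists (of_downs P); rewrite of_downsK.
have thK : cancel theta theta' by move=> A; have [x ->] := upsP A; rewrite thE th'E.
have th'K : cancel theta' theta.
  by move=> P; have [x ->] := downsP P; rewrite th'E thE.
have stK : cancel star star'.
  by move=> P; have [x ->] := downsP P; rewrite stE st'E (ibs_negK hL).
have st'K : cancel star' star.
  by move=> A; have [x ->] := upsP A; rewrite st'E stE (ibs_negK hL).
exists theta, star; split=> //.
(* By (I7), zero is below everything for the join order, so [down] of zero is the least member. *)
have least (P : downs L) : val (@to_downs L bzero) `<=` val P.
  by have [x ->] := downsP P; apply/(sub_down hL)/(ibs_join0x hL).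
unshelve eexists.
  refine (@IDBSOfSets _ _ _ _ theta star (ups_setI_closed hL)
    (downs_setU_closed hL) _ least theta' thK th'K star' stK st'K _ _ _ _ _).
  - move=> P Q; have [x ->] := downsP P; have [y ->] := downsP Q.
    rewrite !stE /=; split=> [/(sub_down hL)|/(sub_up hL)] xy.
      by apply/(sub_up hL)/(le_meet_neg hL).
    by apply/(sub_down hL)/(le_meet_neg hL).
  - by move=> A /=; have [x ->] := upsP A; rewrite thE stE st'E th'E.
  - move=> A B C /=; have [x ->] := upsP A; have [y ->] := upsP B.
    have [z ->] := upsP C.
    by rewrite !(thE, th'E, cap_to_ups hL, cup_to_downs hL) ibs_meet_joinr.
  - move=> P Q R /=; have [x ->] := downsP P; have [y ->] := downsP Q.
    have [z ->] := downsP R.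
    by rewrite !(thE, th'E, cap_to_ups hL, cup_to_downs hL) ibs_join_meetr.
  - move=> A B; have [x ->] := upsP A; have [y ->] := upsP B; cbv zeta.
    rewrite !(thE, stE, cap_to_ups hL).
    by apply/(sub_down hL); apply: le_join_local_zero.
(* The isomorphism is the inverse of the map sending [x] to [up x]. *)
exists (@of_ups L); first by exists (@to_ups L); [apply: of_upsK|apply: to_upsK].
split=> [A B|A B|A||]; rewrite /=.
- have [x ->] := upsP A; have [y ->] := upsP B.
  by rewrite (cap_to_ups hL) !to_upsK.
- have [x ->] := upsP A; have [y ->] := upsP B.
  by rewrite !(thE, th'E, cup_to_downs hL) !to_upsK.
- by have [x ->] := upsP A; rewrite thE stE !to_upsK.
- by rewrite th'E to_upsK.
- by rewrite stE to_upsK // (ibs_zeroE hL) (ibs_negK hL).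
Qed.
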